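(* Let $\mathrm{TM}_{1state}$ denote the class of languages $L(M)$ recognized by one-state Turing machines $M$. Then: (i) there exists a regular language that is not in $\mathrm{TM}_{1state}$, for example $\{1\}$; (ii) there exists a language in $\mathrm{TM}_{1state}$ that is not context-free.
   Context: A one-state Turing machine is a tuple $\langle \{q\}, \Sigma, \Gamma, q, H, \delta\rangle$ with the following components: a unique state $q$; an input alphabet $\Sigma$ not containing the blank symbol $\sqcup$; a tape alphabet $\Gamma\supseteq\Sigma\cup\{\sqcup\}$; a set of halting symbols $H\subseteq\Gamma$; and a transition function $\delta:\Gamma\setminus H\to\Gamma\times\{L,R\}$. The tape is infinite in both directions. On input $x\in\Sigma^*$, the tape holds $x$ with blanks everywhere else, and the head starts on the leftmost symbol of $x$ (on a blank cell if $x$ is empty). At each step, if the scanned symbol is in $H$, the machine halts. Otherwise, with $\delta(a)=(b,D)$ for the scanned symbol $a$, it writes $b$ and moves one cell in direction $D$. The language recognized by $M$ is $L(M)=\{x\in\Sigma^*\mid M\text{ halts on input }x\}$. *)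

(* Defs.v *)
From Stdlib Require Import ZArith.
From mathcomp Require Import all_boot.

Set Implicit Arguments.
Unset Strict Implicit.
Unset Printing Implicit Defensive.

Definition language (S : finType) := seq S -> Prop.

(* Tape alphabet G (finite), input symbols embedded by an injective map
   [inp], a blank symbol not among the input symbols, halting symbols [halt],
   and the transition function [delta] (its values on halting symbols are
   never used).  Direction: [true] = R (+1), [false] = L (-1). *)
Record TM1 (S : finType) := MkTM1 {
  tape_alph : finType;
  inp : S -> tape_alph;
  inp_inj : injective inp;
  blank : tape_alph;
  blank_notin : forall a : S, inp a <> blank;
  halt : pred tape_alph;
  delta : tape_alph -> tape_alph * bool
}.
Arguments inp {S} M _ : rename.
Arguments blank {S} M : rename.
Arguments halt {S} M _ : rename.
Arguments delta {S} M _ : rename.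

Definition config (S : finType) (M : TM1 S) : Type := ((Z -> tape_alph M) * Z)%type.

Definition init_config (S : finType) (M : TM1 S) (x : seq S) : config M :=
  (fun i : Z =>
     if ((0 <=? i)%Z && (i <? Z.of_nat (size x))%Z)
     then match x with
          | [::] => blank M
          | a :: _ => inp M (nth a x (Z.to_nat i))
          end
     else blank M,
   0%Z).

Definition scanned (S : finType) (M : TM1 S) (c : config M) : tape_alph M :=
  c.1 c.2.

Definition step (S : finType) (M : TM1 S) (c : config M) : config M :=
  let a := scanned c in
  if halt M a then c
  else let (b, d) := delta M a in
       (fun i : Z => if Z.eqb i c.2 then b else c.1 i,
        if d then (c.2 + 1)%Z else (c.2 - 1)%Z).

Definition halts_on (S : finType) (M : TM1 S) (x : seq S) : Prop :=
  exists n : nat, halt M (scanned (iter n (@step S M) (init_config M x))).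

Definition lang_TM1 (S : finType) (M : TM1 S) : language S :=
  fun x => halts_on M x.

Definition in_TM1state (S : finType) (L : language S) : Prop :=
  exists M : TM1 S, forall x, L x <-> lang_TM1 M x.

Record DFA (S : finType) := MkDFA {
  dstate : finType;
  dstart : dstate;
  dfinal : pred dstate;
  dtrans : dstate -> S -> dstate
}.
Arguments dstart {S} A : rename.
Arguments dfinal {S} A _ : rename.

Definition dfa_accepts (S : finType) (A : DFA S) (w : seq S) : bool :=
  dfinal A (foldl (@dtrans S A) (dstart A) w).

Definition regular (S : finType) (L : language S) : Prop :=
  exists A : DFA S, forall w, L w <-> dfa_accepts A w.

Record CFG (S : finType) := MkCFG {
  nonterm : finType;
  gstart : nonterm;
  rules : seq (nonterm * seq (nonterm + S))
}.
Arguments gstart {S} G : rename.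
Arguments rules {S} G : rename.

Inductive derive1 (S : finType) (G : CFG S) :
  seq (nonterm G + S) -> seq (nonterm G + S) -> Prop :=
| Derive1 : forall (u v : seq (nonterm G + S)) (A : nonterm G) (r : seq (nonterm G + S)),
    (A, r) \in rules G -> @derive1 S G (u ++ inl A :: v) (u ++ r ++ v).

Inductive derives (S : finType) (G : CFG S) :
  seq (nonterm G + S) -> seq (nonterm G + S) -> Prop :=
| DerivesRefl : forall u, @derives S G u u
| DerivesStep : forall u v w, @derive1 S G u v -> @derives S G v w -> @derives S G u w.

Definition cfg_lang (S : finType) (G : CFG S) : language S :=
  fun w => @derives S G [:: inl (gstart G)] (map inr w).

Definition context_free (S : finType) (L : language S) : Prop :=
  exists G : CFG S, forall w, L w <-> cfg_lang G w.

(* Main.v *)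
Require Import Defs.
From Stdlib Require Import ZArith Lia.
From mathcomp Require Import all_boot zify.

Set Implicit Arguments.
Unset Strict Implicit.
Unset Printing Implicit Defensive.

(** (i) Suppose that the machine halts on [1].  On a fresh blank it always moves
    in the same direction, so a run that enters the blank half-line on that
    side never halts.  If blanks move right, the run on [1] therefore stays on
    the cells i <= 0 and is also the run on [11].  If blanks move left, the
    first move is to the right and the run stays on the cells i >= 0; after
    one step on [11] the head faces a copy of the input [1], shifted by one
    cell, and the run on [1] is repeated there.

    (ii) In a one-state machine a cell chooses its successive moves from the
    number of visits alone, so the number of entries from the left into a cell
    determines the number of entries into the next one.  Let 1 (= [true]) move
    R, R, L cyclically, which doubles this number, let 0 (= [false]) move L and
    then R, L cyclically, which decreases it by one, and let a blank halt at
    its second visit.  Then 1^n 0^m is accepted iff m + 2 <= 2^n.  Pumping down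
    1^n 0^(2^n - 2), or pumping up when only zeros are pumped, leaves the
    language. *)

(** * The pumping lemma *)

Section Pumping.

Variables (S : finType) (G : CFG S).
Local Notation sym := (nonterm G + S)%type.

(** Parse forests, one tree for each symbol of the sentential form, so that trees can be cut and
    grafted by structural induction. *)
Inductive der : seq sym -> seq S -> Prop :=
| DerNil : der [::] [::]
| DerTerm a ss w : der ss w -> der (inr a :: ss) (a :: w)
| DerNonterm A r ss w1 w2 : (A, r) \in rules G -> der r w1 -> der ss w2 ->
    der (inl A :: ss) (w1 ++ w2).

Lemma der_cat ss1 ss2 w1 w2 : der ss1 w1 -> der ss2 w2 ->
  der (ss1 ++ ss2) (w1 ++ w2).
Proof.
move=> d1 d2; elim: d1 => //= [a ss w _ IH|A r ss u1 u2 Ar dr _ _ IH].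
  exact: DerTerm.
by rewrite -catA; apply: DerNonterm Ar dr IH.
Qed.

Lemma der_catP ss1 ss2 w : der (ss1 ++ ss2) w ->
  exists w1 w2, [/\ w = w1 ++ w2, der ss1 w1 & der ss2 w2].
Proof.
elim: ss1 w => [|s ss1 IH] w /= d.
  by exists [::], w; split => //; exact: DerNil.
inversion d as [|a ss u du|A r ss u1 u2 Ar dr du]; subst.
  have [w1 [w2 [-> d1 d2]]] := IH _ du.
  by exists (a :: w1), w2; split => //; apply: DerTerm.
have [w1 [w2 [-> d1 d2]]] := IH _ du.
exists (u1 ++ w1), w2; split => //; first by rewrite catA.
exact: DerNonterm Ar dr d1.
Qed.

Lemma der_terminals w : der (map inr w) w.
Proof. by elim: w => [|a w IH] /=; [exact: DerNil|exact: DerTerm]. Qed.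

Lemma derives_der ss w : derives ss (map inr w) -> der ss w.
Proof.
move E : (map inr w) => t d; elim: d E => [u <-|u v t' uv _ IH E].
  exact: der_terminals.
have {IH} := IH E; case: uv => {}u {}v A r Ar.
case/der_catP => w1 [w2 [-> d1 /der_catP [w3 [w4 [-> d3 d4]]]]].
by apply: der_cat => //; apply: DerNonterm Ar d3 d4.
Qed.

Lemma derives_trans (u v w : seq sym) :
  derives u v -> derives v w -> derives u w.
Proof.
by elim=> [//|u1 u2 u3 u12 _ IH /IH]; apply: DerivesStep.
Qed.

Lemma derives_ctx (p q u v : seq sym) :
  derives u v -> derives (p ++ u ++ q) (p ++ v ++ q).
Proof.
elim=> [{}u|u1 u2 u3 u12 _ IH]; first exact: DerivesRefl.
apply: DerivesStep IH; case: u12 => a b A r Ar.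
have := Derive1 (p ++ a) (b ++ q) Ar.
by rewrite -!catA.
Qed.

Lemma der_derives ss w : der ss w -> derives ss (map inr w).
Proof.
elim=> [|a {}ss {}w _ IH|A r {}ss w1 w2 Ar _ IH1 _ IH2].
- exact: DerivesRefl.
- by have := derives_ctx [:: inr a] [::] IH; rewrite !cats0.
- have s1 : derive1 (inl A :: ss) (r ++ ss) by apply: (@Derive1 S G [::]).
  apply: (DerivesStep s1); rewrite map_cat.
  have := derives_ctx [::] ss IH1; move/derives_trans; apply.
  by have := derives_ctx (map inr w1) [::] IH2; rewrite !cats0.
Qed.

(* [fder V ss w]: a derivation in which the nonterminals on each branch are
   pairwise distinct and avoid [V]. *)
Inductive fder : {set nonterm G} -> seq sym -> seq S -> Prop :=
| FderNil V : fder V [::] [::]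
| FderTerm V a ss w : fder V ss w -> fder V (inr a :: ss) (a :: w)
| FderNonterm (V : {set nonterm G}) A r ss w1 w2 : (A, r) \in rules G -> A \notin V ->
    fder (A |: V) r w1 -> fder V ss w2 -> fder V (inl A :: ss) (w1 ++ w2).

Lemma fder_der V ss w : fder V ss w -> der ss w.
Proof.
elim=> [V'|V' a {}ss {}w _|V' A r {}ss w1 w2 Ar _ _ d1 _ d2].
- exact: DerNil.
- exact: DerTerm.
- exact: DerNonterm Ar d1 d2.
Qed.

Lemma fder_subset (V V' : {set nonterm G}) ss w : V' \subset V -> fder V ss w -> fder V' ss w.
Proof.
move=> sV d; elim: d V' sV =>
  [U|U a {}ss {}w _ IH|U A r {}ss w1 w2 Ar AU _ IH1 _ IH2] V' sV.
- exact: FderNil.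
- exact/FderTerm/IH.
- apply: (FderNonterm Ar); last exact: IH2.
    by apply: contra AU; apply: subsetP.
  by apply: IH1; apply: setUS.
Qed.

(** The successor keeps the bound positive even if every right-hand side is empty. *)
Definition rule_bound := (\max_(p <- rules G) size p.2).+1.

Lemma size_rule A r : (A, r) \in rules G -> size r <= rule_bound.
Proof.
move=> Ar; apply: leqW.
by rewrite (big_rem (A, r)) //= leq_maxl.
Qed.

(** Each level of a tree uses up a nonterminal outside [V] and multiplies the width by at most
    [rule_bound]. *)
Lemma size_fder V ss w : fder V ss w ->
  size w <= size ss * rule_bound ^ #|~: V|.
Proof.
elim=> [V'|V' a {}ss {}w _ IH|V' A r {}ss w1 w2 Ar AV _ IH1 _ IH2] //=.
  by rewrite mulSn -add1n leq_add // expn_gt0.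
rewrite size_cat mulSn leq_add //; apply: leq_trans IH1 _.
have -> : #|~: V'| = #|~: (A |: V')|.+1.
  by rewrite (cardsD1 A) inE AV setCU setDE setIC.
rewrite expnS leq_mul2r; apply/orP; right.
exact: size_rule Ar.
Qed.

(** A forest with a hole at [A], kept only as the function that fills the hole; nesting contexts is
    then function composition. *)
Definition context ss A u z :=
  forall x, der [:: inl A] x -> der ss (u ++ x ++ z).

Lemma context_cons_l s ss A u z v : der [:: s] v -> context ss A u z ->
  context (s :: ss) A (v ++ u) z.
Proof. by move=> ds ctx x /ctx dx; rewrite -catA; apply: (der_cat ds dx). Qed.

Lemma context_nonterm_r B r ss A u z w : (B, r) \in rules G ->
  context r A u z -> der ss w -> context (inl B :: ss) A u (z ++ w).
Proof.
move=> Br ctx ds x /ctx dx.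
by have := DerNonterm Br dx ds; rewrite -!catA.
Qed.

(** Either [A] labels no node, and it can be added to the forbidden set, or the forest is cut at a
    node labelled [A]. *)
Lemma fder_setU1 A V ss w : fder V ss w ->
  fder (A |: V) ss w \/
  exists v x y, [/\ w = v ++ x ++ y, fder V [:: inl A] x & context ss A v y].
Proof.
elim=> [U|U a {}ss {}w _ IH|U B r {}ss w1 w2 Br BU d1 IH1 d2 IH2].
- by left; apply: FderNil.
- case: IH => [d|[v [x [y [-> dx ctx]]]]]; [left|right].
    exact: FderTerm.
  exists (a :: v), x, y; split=> //.
  apply: (context_cons_l (v := [:: a])) ctx.
  exact/DerTerm/DerNil.
- have [BA|BA] := eqVneq B A.
    right; exists [::], w1, w2; split => //.
      rewrite -[w1]cats0 -BA; apply: FderNonterm Br BU d1 _; exact: FderNil.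
    rewrite -BA => x dx; exact: (der_cat dx (fder_der d2)).
  case: IH1 => [{}d1|[v [x [y [-> dx ctx]]]]]; last first.
    right; exists v, x, (y ++ w2); split; first by rewrite -!catA.
      by apply: fder_subset dx; apply: subsetUr.
    exact: context_nonterm_r Br ctx (fder_der d2).
  case: IH2 => [{}d2|[v [x [y [-> dx ctx]]]]]; last first.
    right; exists (w1 ++ v), x, y; split => //; first by rewrite -!catA.
    apply: context_cons_l ctx; rewrite -[w1]cats0.
    by apply: (DerNonterm Br) DerNil; apply: fder_der d1.
  left; apply: (FderNonterm Br) d2; first by rewrite !inE negb_or BA.
  by rewrite setUCA.
Qed.

Definition pump_bound := rule_bound ^ #|nonterm G|.+1.

(** Working upwards from the leaves, consider a root [A] whose children are repetition-free. If [A]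
    recurs below, the two occurrences give the pump; the root adds one level, hence the exponent in
    [pump_bound]. *)
Lemma der_pump ss w : der ss w ->
  fder set0 ss w \/
  exists A u v x y z, [/\ w = u ++ v ++ x ++ y ++ z,
    size (v ++ x ++ y) <= pump_bound, v ++ y != [::], der [:: inl A] x &
    context ss A u z /\ context [:: inl A] A v y].
Proof.
elim=> [|a {}ss {}w _ IH|A r {}ss w1 w2 Ar d1 IH1 d2 IH2].
- by left; apply: FderNil.
- case: IH => [d|[A [u [v [x [y [z [-> sz vy dx [c1 c2]]]]]]]]].
    by left; apply: FderTerm.
  right; exists A, (a :: u), v, x, y, z; split=> //; split=> //.
  apply: (context_cons_l (v := [:: a])) c1; exact/DerTerm/DerNil.
- have dA : der [:: inl A] w1.
    by rewrite -[w1]cats0; apply: DerNonterm Ar d1 DerNil.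
  case: IH1 => [f1|[B [u [v [x [y [z [-> sz vy dx [c1 c2]]]]]]]]]; last first.
    right; exists B, u, v, x, y, (z ++ w2); split=> //; first by rewrite -!catA.
    by split=> //; apply: context_nonterm_r Ar c1 d2.
  case: IH2 => [f2|[B [u [v [x [y [z [-> sz vy dx [c1 c2]]]]]]]]]; last first.
    right; exists B, (w1 ++ u), v, x, y, z; split=> //; first by rewrite -!catA.
    by split=> //; apply: context_cons_l c1.
  have [f1'|[v [x [y [Ew fx ctx]]]]] := fder_setU1 A f1.
    by left; apply: FderNonterm Ar _ f1' f2; rewrite inE.
  have [vy|vy] := eqVneq (v ++ y) [::].
    (* An empty pump means that the inner tree yields the same word, so it replaces the outer one
       and no repetition remains. *)
    left; move: Ew fx; case: v y vy {ctx} => [|//] [|//] _ /=.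
    rewrite cats0 => <- fA; inversion fA as [| |? ? r' ? u1 u2 Ar' AV du d0]; subst.
    by inversion d0; subst; rewrite cats0; apply: FderNonterm Ar' AV du f2.
  right; exists A, [::], v, x, y, w2; split=> //.
  + by rewrite Ew -!catA.
  + rewrite -Ew; apply: leq_trans (size_fder f1) _.
    rewrite setC0 cardsT /pump_bound expnS leq_mul2r; apply/orP; right.
    exact: size_rule Ar.
  + exact: fder_der fx.
  + split; first by move=> t dt; apply: (der_cat dt d2).
    move=> t /ctx dt; rewrite -[_ ++ _]cats0.
    exact: DerNonterm Ar dt DerNil.
Qed.

End Pumping.

Lemma pumping (S : finType) (L : language S) : context_free L ->
  exists K, forall w, L w -> K < size w ->
    exists u v x y z, [/\ w = u ++ v ++ x ++ y ++ z, size (v ++ x ++ y) <= K,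
      v ++ y != [::], L (u ++ x ++ z) & L (u ++ v ++ v ++ x ++ y ++ y ++ z)].
Proof.
case=> G LG; exists (pump_bound G) => w /LG/derives_der/der_pump.
case=> [/size_fder|[A [u [v [x [y [z [-> sz vy dx [c1 c2]]]]]]]]].
  rewrite mul1n setC0 cardsT => sz; rewrite ltnNge => /negP [].
  by apply: leq_trans sz _; rewrite leq_pexp2l.
move=> _; exists u, v, x, y, z; split=> //; apply/LG/der_derives; first exact: c1.
by have := c1 _ (c2 _ (c2 _ dx)); rewrite -!catA.
Qed.

(** * Halting *)

Section Halting.

Variables (S : finType) (M : TM1 S).
Local Notation Gamma := (tape_alph M).

Definition halts (c : config M) :=
  exists n, halt M (scanned (iter n (@step S M) c)).

Lemma halt_halts (c : config M) : halt M (scanned c) -> halts c.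
Proof. by exists 0. Qed.

Lemma halts_step (c : config M) : halts c <-> halts (step c).
Proof.
split=> [[n]|[n hn]]; last by exists n.+1; rewrite iterSr.
elim: n c => [|n _] c /=; last by rewrite -iterS iterSr; exists n.
by move=> h; exists 0; rewrite /= /step h.
Qed.

Definition write (t : Z -> Gamma) p b : Z -> Gamma :=
  fun i => if Z.eqb i p then b else t i.

Lemma write_eq t p b : write t p b p = b.
Proof. by rewrite /write Z.eqb_refl. Qed.

Lemma write_neq t p b i : i <> p -> write t p b i = t i.
Proof. by rewrite /write => /Z.eqb_neq ->. Qed.

Definition shift (d : bool) : Z := if d then 1%Z else (-1)%Z.

Lemma stepE t p a : t p = a -> ~~ halt M a ->
  step (t, p) = (write t p (delta M a).1, (p + shift (delta M a).2)%Z).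
Proof.
move=> <- ha; rewrite /step /scanned /= (negbTE ha).
by case: (delta M _) => b [].
Qed.

Hypothesis blankN : ~~ halt M (blank M).
Local Notation sigma := (shift (delta M (blank M)).2).

Lemma shift_cases d : shift d = 1%Z \/ shift d = (-1)%Z.
Proof. by case: d; [left|right]. Qed.

(** The head always leaves the written cell behind it and meets a fresh blank again. Multiplication
    by [sigma] orders the cells along the direction of the blank, which treats both directions at
    once. *)
Lemma blanks_ahead_not_halts t p :
  (forall i, (sigma * p <= sigma * i)%Z -> t i = blank M) -> ~ halts (t, p).
Proof.
move=> bl [n]; elim: n t p bl => [|n IH] t p bl.
  by rewrite /scanned /= bl ?(negbTE blankN) //; lia.
rewrite iterSr (stepE (a := blank M)) //; last by apply: bl; lia.
have [E|E] := shift_cases (delta M (blank M)).2; rewrite E in bl IH *;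
by apply: IH => i ip; rewrite write_neq ?bl //; lia.
Qed.

(* The run from [t1] cannot halt once it leaves the half-line [sigma * i <= 0],
   so a run from a tape that agrees with [t1] there halts as well. *)
Lemma halts_transfer s t1 t2 p : (sigma * p <= 0)%Z ->
  (forall i, (sigma * i <= 0)%Z -> t1 i = t2 (i + s)%Z) ->
  (forall i, (0 < sigma * i)%Z -> t1 i = blank M) ->
  halts (t1, p) -> halts (t2, (p + s)%Z).
Proof.
move=> + + + [n]; elim: n t1 t2 p => [|n IH] t1 t2 p Pp E bl.
  by move=> h; apply: halt_halts; rewrite /scanned /= -E.
have [h _|h] := boolP (halt M (t1 p)).
  by apply: halt_halts; rewrite /scanned /= -E.
rewrite iterSr (stepE (a := t1 p)) //.
move=> hn; apply/halts_step; rewrite (stepE (a := t1 p)) -?E //.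
set b := (delta M (t1 p)).1 in hn *.
set d := (delta M (t1 p)).2 in hn *.
have bl' i : (0 < sigma * i)%Z -> write t1 p b i = blank M.
  by move=> i0; rewrite write_neq ?bl // => ip; subst i; lia.
have [Pq|Pq] : (sigma * (p + shift d) <= 0 \/ 0 < sigma * (p + shift d))%Z.
  by lia.
- have -> : (p + s + shift d = p + shift d + s)%Z by lia.
  apply: IH hn => // i Pi; rewrite /write.
  case: Z.eqb_spec => [->|ip]; first by rewrite Z.eqb_refl.
  have -> : Z.eqb (i + s) (p + s) = false by apply/Z.eqb_neq; lia.
  exact: E.
- case: (@blanks_ahead_not_halts (write t1 p b) (p + shift d)%Z).
    by move=> i hi; apply: bl'; lia.
  by exists n.
Qed.

End Halting.

(** * A one-word language: regular, but not recognized by one state *)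

Lemma singleton_not_TM1 (S : finType) (a : S) :
  ~ in_TM1state (fun w : seq S => w = [:: a]).
Proof.
case=> M LM.
have h1 : lang_TM1 M [:: a] by apply/LM.
have h0 : ~ lang_TM1 M [::] by move/LM.
suff h2 : lang_TM1 M [:: a; a] by move/LM: h2.
have blankN : ~~ halt M (blank M).
  by apply/negP => hb; apply: h0; exists 0; rewrite /scanned /init_config.
pose t1 := (init_config M [:: a]).1.
pose t2 := (init_config M [:: a; a]).1.
have t1E i : t1 i = if Z.eqb i 0 then inp M a else blank M.
  rewrite /t1 /=; case: Z.eqb_spec => [-> //|i0].
  by case: ifP => // /andP [/Z.leb_le ? /Z.ltb_lt ?]; lia.
have t2E i : t2 i = if Z.eqb i 0 || Z.eqb i 1 then inp M a else blank M.
  rewrite /t2 /=; case: Z.eqb_spec => [-> //|i0].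
  case: Z.eqb_spec => [-> //|i1].
  by case: ifP => // /andP [/Z.leb_le ? /Z.ltb_lt ?]; lia.
have {}h1 : halts (t1, 0%Z) := h1.
change (halts (t2, 0%Z)).
case D: (delta M (blank M)).2.
- apply: (halts_transfer (s := 0%Z) blankN) h1; rewrite D -[shift _]/1%Z // => i hi.
  + have -> : (i + 0 = i)%Z by lia.
    rewrite t1E t2E; case: Z.eqb_spec => //= _.
    by case: Z.eqb_spec => // ?; lia.
  + by rewrite t1E; case: Z.eqb_spec => // ?; lia.
- have [ha|ha] := boolP (halt M (inp M a)); first exact: halt_halts.
  have /halts_step h := h1; apply/halts_step; move: h.
  rewrite (stepE (a := inp M a)) // (stepE (a := inp M a)) //.
  case: (delta M (inp M a)) => b [] /= h.
  (* The second letter plays the role of the whole input; the symbol [b] left at cell 0 corresponds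
     to cell -1, outside the half-line to be compared. *)
  + apply: (halts_transfer (s := 1%Z) blankN) h1; rewrite D -[shift _]/(-1)%Z // => i hi.
    * rewrite write_neq ?t1E ?t2E; last by lia.
      have -> : Z.eqb (i + 1) 0 = false by apply/Z.eqb_neq; lia.
      by do 2 case: Z.eqb_spec => //; lia.
    * by rewrite t1E; case: Z.eqb_spec => // ?; lia.
  (* A first move to the left would lose the head among the blanks already on the one-letter
     input. *)
  + case: (blanks_ahead_not_halts blankN _ h); rewrite D -[shift _]/(-1)%Z => i hi.
    rewrite write_neq ?t1E; last by lia.
    by case: Z.eqb_spec => // ?; lia.
Qed.

Lemma singleton_regular (S : finType) (a : S) :
  regular (fun w : seq S => w = [:: a]).
Proof.
pose tr (q : option bool) b :=
  if q is Some false then if b == a then Some true else None else None.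
exists (MkDFA (Some false) (pred1 (Some true)) tr) => w; rewrite /dfa_accepts /=.
have dead v : foldl tr None v = None by elim: v.
case: w => [|b [|c w]] /=.
- by split.
- by have [->|/eqP ba] := eqVneq b a; split=> // -[].
- by have [_|_] := eqVneq b a; rewrite ?dead; split.
Qed.

(** * A machine with a language that is not context-free *)

(* A tape symbol is a letter ([None] for blank) with a phase, initially [None]. *)
Definition sweep_delta (g : option bool * option bool) :
    (option bool * option bool) * bool :=
  match g with
  | (Some true, None) => ((Some true, Some false), true)
  | (Some true, Some false) => ((Some true, Some true), true)
  | (Some true, Some true) => ((Some true, None), false)
  | (Some false, Some false) => ((Some false, Some true), true)
  | (Some false, _) => ((Some false, Some false), false)
  | (None, _) => ((None, Some true), false)
  end.

Definition sweep_halt (g : option bool * option bool) :=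
  if g is (None, Some _) then true else false.

Lemma sweep_inp_inj :
  injective (fun b : bool => (Some b, None : option bool)).
Proof. by move=> b c []. Qed.

Lemma sweep_blank_notin (b : bool) :
  (Some b, None : option bool) <> (None, None).
Proof. by []. Qed.

Definition sweep : TM1 bool :=
  MkTM1 sweep_inp_inj sweep_blank_notin sweep_halt sweep_delta.

(* The number of entries from the left into the cell that follows [w], after [N]
   entries into the first cell of [w]. *)
Definition entries (w : seq bool) (N : nat) : nat :=
  foldl (fun N (b : bool) => if b then N.*2 else N.-1) N w.

Lemma entriesS w N : entries w N <= entries w N.+1.
Proof.
have homo : {homo entries w : M N / M <= N}.
  elim: w => [//|[] w IH] M N' MN; apply: IH; first by rewrite leq_double.
  by rewrite -!subn1 leq_sub2r.
exact: homo.
Qed.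

Lemma entries0 w : entries w 0 = 0.
Proof. by elim: w => [//|[]]. Qed.

(* The tape from the first cell of [w] on, after [N] excursions into it. *)
Fixpoint swept (w : seq bool) (N : nat) : seq (tape_alph sweep) :=
  match w with
  | [::] => [:: (None, if N is 0 then None else Some true)]
  | true :: w' => (Some true, None) :: swept w' N.*2
  | false :: w' => (Some false, if N is 0 then None else Some false)
                     :: swept w' N.-1
  end.

Fixpoint tape_at (t : Z -> tape_alph sweep) (p : Z) s : Prop :=
  if s is a :: s' then t p = a /\ tape_at t (p + 1)%Z s' else True.

Lemma eq_tape_at t t' p s : (forall i, (p <= i)%Z -> t' i = t i) ->
  tape_at t p s -> tape_at t' p s.
Proof.
elim: s p => [//|a s IH] p E /= [<- ts]; split; first by apply: E; lia.
by apply: IH ts => i hi; apply: E; lia.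
Qed.

Lemma tape_at_write t p b q s : (p < q)%Z -> tape_at t q s ->
  tape_at (write t p b) q s.
Proof. by move=> pq; apply: eq_tape_at => i qi; rewrite write_neq //; lia. Qed.

Lemma halts_sweep (t : Z -> tape_alph sweep) p (a : tape_alph sweep) :
  t p = a -> ~~ sweep_halt a ->
  halts (t, p) <->
  halts (M := sweep) (write t p (sweep_delta a).1, (p + shift (sweep_delta a).2)%Z).
Proof.
by move=> tp ha; rewrite -(stepE (M := sweep) tp ha); apply: halts_step.
Qed.

(** Outcome of entry number [N.+1] from the left: the head comes back to [p - 1], or the final blank
    is visited a second time. Equivalence of halting replaces counting steps. *)
Definition excursion w N (t : Z -> tape_alph sweep) p :=
  if entries w N.+1 <= 1 then
    exists t', [/\ halts (t, p) <-> halts (M := sweep) (t', p - 1)%Z,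
      tape_at t' p (swept w N.+1) & forall i, (i < p)%Z -> t' i = t i]
  else halts (M := sweep) (t, p).

(** Induction on [w]: a 1 makes two excursions into the rest before returning to its initial phase,
    while a 0 makes none at its first entry and one at each later entry. *)
Lemma excursionP w N t p : entries w N <= 1 -> tape_at t p (swept w N) ->
  excursion w N t p.
Proof.
elim: w N t p => [|b w IH] N t p.
  (* On the blank only [N = 0] (turn back) and [N = 1] (halt) are possible. *)
  case: N => [|[|//]] _ /= [tp _]; rewrite /excursion /=; last first.
    by apply: halt_halts; rewrite /scanned /= tp.
  exists (write (M := sweep) t p (None, Some true)); split.
  - exact: (halts_sweep tp).
  - by rewrite write_eq.
  - by move=> i ip; rewrite write_neq //; lia.
have pp : (p < p + 1)%Z by lia.
case: b => [|] /= le1 [tp ts].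
- pose t1 : Z -> tape_alph sweep := write t p (Some true, Some false).
  have H1 : halts (t, p) <-> halts (t1, p + 1)%Z by exact: (halts_sweep tp).
  have := IH N.*2 t1 (p + 1)%Z le1 (tape_at_write _ pp ts).
  rewrite /excursion [entries (true :: w) _]/=.
  (* If the first inner excursion halts, the larger count for [N.+1], with one more inner entry,
     exceeds 1 by monotonicity. *)
  case: ifP => le2; last first.
    move=> h1; rewrite ifF; first exact/H1.
    apply: contraFF le2; apply: leq_trans; exact: entriesS.
  case=> t2 [H2 ts2 E2].
  have t2p : t2 p = (Some true, Some false) by rewrite E2 // /t1 write_eq.
  pose t3 : Z -> tape_alph sweep := write t2 p (Some true, Some true).
  have H3 : halts (t2, p) <-> halts (t3, p + 1)%Z by exact: (halts_sweep t2p).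
  have E1 : (p + 1 - 1 = p)%Z by lia.
  rewrite E1 in H2.
  have := IH N.*2.+1 t3 (p + 1)%Z le2 (tape_at_write _ pp ts2).
  rewrite /excursion.
  rewrite /= doubleS.
  case: ifP => le3; last by move=> h; apply/H1/H2/H3.
  case=> t4 [H4 ts4 E4]; rewrite E1 in H4.
  have t4p : t4 p = (Some true, Some true) by rewrite E4 // /t3 write_eq.
  exists (write (M := sweep) t4 p (Some true, None)); split.
  + rewrite H1 H2 H3 H4; exact: (halts_sweep t4p).
  + rewrite write_eq; split=> //.
    by apply: tape_at_write ts4; lia.
  + move=> i ip; rewrite write_neq ?E4 /t3 ?write_neq ?E2 /t1 ?write_neq //; lia.
(* Here [N.-1] is truncated: the first entry into a 0 turns back at once and leaves the rest
   untouched. *)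
- case: N le1 tp ts => [|N] /= le1 tp ts.
    rewrite /excursion /= le1.
    exists (write (M := sweep) t p (Some false, Some false)); split.
    + exact: (halts_sweep tp).
    + by rewrite /= write_eq; split=> //; apply: tape_at_write ts; lia.
    + by move=> i ip; rewrite write_neq //; lia.
  pose t1 : Z -> tape_alph sweep := write t p (Some false, Some true).
  have H1 : halts (t, p) <-> halts (t1, p + 1)%Z by exact: (halts_sweep tp).
  have := IH N t1 (p + 1)%Z le1 (tape_at_write _ pp ts).
  rewrite /excursion /=.
  case: ifP => le2; last by move=> h; apply/H1.
  case=> t2 [H2 ts2 E2].
  have E1 : (p + 1 - 1 = p)%Z by lia.
  rewrite E1 in H2.
  have t2p : t2 p = (Some false, Some true) by rewrite E2 // /t1 write_eq.
  exists (write (M := sweep) t2 p (Some false, Some false)); split.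
  + rewrite H1 H2; exact: (halts_sweep t2p).
  + rewrite write_eq; split=> //.
    by apply: tape_at_write ts2; lia.
  + move=> i ip; rewrite write_neq ?E2 /t1 ?write_neq //; lia.
Qed.

Lemma init_swept w (t : Z -> tape_alph sweep) p :
  (forall i, i < size w -> t (p + Z.of_nat i)%Z = (Some (nth true w i), None)) ->
  t (p + Z.of_nat (size w))%Z = (None, None) ->
  tape_at t p (swept w 0).
Proof.
elim: w p => [|b w IH] p tw te.
  by rewrite /= -te Z.add_0_r.
have tp : t p = (Some b, None) by rewrite -(tw 0) // Z.add_0_r.
have ts : tape_at t (p + 1)%Z (swept w 0).
  apply: IH => [i iw|].
    by rewrite -(tw i.+1 iw); congr t; lia.
  by rewrite -te; congr t => /=; lia.
by case: b tp {tw te} => /= tp.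
Qed.

Lemma lang_sweep w : lang_TM1 sweep w <-> 1 < entries w 1.
Proof.
pose t : Z -> tape_alph sweep := (init_config sweep w).1.
change (halts (t, 0%Z) <-> 1 < entries w 1).
have tw : tape_at t 0 (swept w 0).
  apply: init_swept => [i iw|]; rewrite {}/t /=.
    have -> /= : ((0 <=? Z.of_nat i) && (Z.of_nat i <? Z.of_nat (size w)))%Z.
      apply/andP; split; first by apply/Z.leb_le; lia.
      exact/Z.ltb_lt/Nat2Z.inj_lt/ltP.
    case: w iw => // b w iw; rewrite Nat2Z.id.
    by rewrite (set_nth_default true).
  by rewrite Z.ltb_irrefl andbF.
have := excursionP (leq_trans (eq_leq (entries0 w)) (leq0n 1)) tw.
rewrite /excursion ltnNge; case: ifP => // _ [t' [-> _ tE]]; split=> //.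
(* The whole run is one excursion from cell 0; once it returns, the head runs left over blanks
   forever. *)
move=> h; exfalso; move: h; apply: blanks_ahead_not_halts => // i.
rewrite -[shift _]/(-1)%Z => hi.
rewrite tE ?/t /=; last by lia.
by case: Z.leb_spec => //= ?; lia.
Qed.

(** * Pumping the words 1^n 0^m *)

Lemma entries_nseq n m N :
  entries (nseq n true ++ nseq m false) N = N * 2 ^ n - m.
Proof.
elim: n N => [|n IH] N /=; last by rewrite IH -muln2 -mulnA -expnS.
elim: m N => [|m IH] N /=; first by rewrite expn0 muln1 subn0.
by rewrite IH expn0 !muln1 -subn1 -subnDA.
Qed.

(** The shape 1^n 0^m in pairwise form splits over concatenation, so pumped words need no search for
    the block boundary. *)
Local Notation decreasing := (pairwise (fun b c : bool => c ==> b)).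

Lemma decreasingE w : decreasing w ->
  w = nseq (count id w) true ++ nseq (count negb w) false.
Proof.
elim: w => [//|[] w IH] /= /andP [wb /IH E]; first by rewrite {1}E.
have c0 : count id w = 0.
  by apply/eqP; rewrite -leqn0 leqNgt -has_count -all_predC.
by rewrite c0 {1}E c0.
Qed.

Lemma decreasing_nseq n m : decreasing (nseq n true ++ nseq m false).
Proof.
elim: n => [|n IH] /=; last by rewrite IH andbT; apply/allP => -[].
elim: m => //= m ->; rewrite andbT; apply/allP => b.
by rewrite mem_nseq => /andP [_ /eqP ->].
Qed.

Lemma lang_sweep_decreasing w : decreasing w ->
  lang_TM1 sweep w <-> count negb w + 2 <= 2 ^ count id w.
Proof.
move=> /decreasingE E; rewrite lang_sweep {1}E entries_nseq mul1n.
by rewrite ltn_subRL addn1 -addn2.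
Qed.

Lemma lang_sweep_not_context_free : ~ context_free (lang_TM1 sweep).
Proof.
(* The value [m] is the largest accepted number of zeros, and [n] makes [2 ^ n.-1] exceed [K]. *)
move=> /pumping [K pump]; pose n := K.+2; pose m := 2 ^ n - 2.
have n2 : 2 <= 2 ^ n by rewrite -{1}(expn1 2) leq_exp2l.
have mE : m + 2 = 2 ^ n by rewrite subnK.
pose w := nseq n true ++ nseq m false.
have cT : count id w = n by rewrite count_cat !count_nseq mul1n mul0n addn0.
have cF : count negb w = m by rewrite count_cat !count_nseq mul1n mul0n.
have dw : decreasing w := decreasing_nseq n m.
have Lw : lang_TM1 sweep w.
  by apply/lang_sweep_decreasing => //; rewrite cT cF mE.
have sw : K < size w by rewrite size_cat size_nseq /n; apply: ltn_addr.
have [u [v [x [y [z [Ew sz vy Ldown Lup]]]]]] := pump w Lw sw.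
rewrite {}Ew in dw cT cF.
move: dw; rewrite !pairwise_cat !allrel_catr => dw.
move: (cT) (cF); rewrite !count_cat => cT' cF'.
have [c0|cpos] := posnP (count id (v ++ y)).
(* Only zeros are pumped: repeating them keeps the shape and adds a zero to the maximal number. *)
- have all_false b : b \in v ++ y -> b = false.
    move=> bvy; apply/negbTE; move/eqP: c0; rewrite -leqn0 leqNgt -has_count.
    by rewrite -all_predC => /allP /(_ _ bvy).
  have rel s1 s2 : {subset s1 <= v ++ y} -> {subset s2 <= v ++ y} ->
      allrel (fun b c : bool => c ==> b) s1 s2.
    by move=> s1P s2P; apply/allrelP => b c _ /s2P /all_false ->.
  have vP : {subset v <= v ++ y} by move=> b bv; rewrite mem_cat bv.
  have yP : {subset y <= v ++ y} by move=> b bv; rewrite mem_cat bv orbT.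
  have dup : decreasing (u ++ v ++ v ++ x ++ y ++ y ++ z).
    move: dw; rewrite !pairwise_cat !allrel_catr.
    rewrite (rel v v) // (rel y y) // (rel v y) //.
    rewrite -!andbA; do ?[case/andP => ?] => ?.
    by do ?[apply/andP; split].
  move/(lang_sweep_decreasing dup): Lup.
  have -> : count id (u ++ v ++ v ++ x ++ y ++ y ++ z) = n.
    by move: c0 cT'; rewrite !count_cat; clear; lia.
  move: c0 vy; rewrite -size_eq0 -(count_predC id (v ++ y)) => ->.
  rewrite (@eq_count _ _ negb) //.
  by rewrite -mE -cF' !count_cat; clear; lia.
(* A one is pumped: deleting it at least halves the bound, a loss of at least [2 ^ K.+1], while at
   most [K] zeros disappear. *)
- have ddown : decreasing (u ++ x ++ z).
    move: dw; rewrite !pairwise_cat !allrel_catr.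
    rewrite -!andbA; do ?[case/andP => ?] => ?.
    by do ?[apply/andP; split].
  move/(lang_sweep_decreasing ddown): Ldown.
  have lt_n : count id (u ++ x ++ z) <= K.+1.
    by move: cpos cT'; rewrite !count_cat /n; clear; lia.
  have := leq_pexp2l (isT : 0 < 2) lt_n.
  have : K.+1 < 2 ^ K.+1 by rewrite ltn_expl.
  have : count negb (v ++ x ++ y) <= K by apply: leq_trans sz; apply: count_size.
  move: mE cF'; rewrite !count_cat /n (expnS _ K.+1).
  by generalize m (2 ^ K.+1); clear; lia.
Qed.

(* Alphabet {0,1} is [bool] with 1 = true. *)
Theorem theorem4 :
  (regular (fun w : seq bool => w = [:: true])
   /\ ~ in_TM1state (fun w : seq bool => w = [:: true]))
  /\ (exists (S : finType) (L : language S), in_TM1state L /\ ~ context_free L).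
Proof.
split; first by split; [exact: singleton_regular|exact: singleton_not_TM1].
exists bool, (lang_TM1 sweep); split; last exact: lang_sweep_not_context_free.
by exists sweep.
Qed.
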